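(* Let $k \ge 2$ be an integer and let $A=\{a_1,\dots,a_k\}$ be a set of $k$ distinct primitive terms. Let $L(A)$ be the language built on $A$, i.e. the set of symbols consisting of all con$(k-1)$nations of $A$ together with all semi-fractional terms $\frac{j}{k-2}a_i$ that represent con$(k-1)$nations of $A$ by means of con$(k-2)$nations of $A$. Then $L(A)$ has exactly $k^2$ symbols.
   Context: Let $A=\{a_1,\dots,a_k\}$ be a set of $k$ distinct elements, called primitive terms. For $0\le m\le k$, a con$m$nation of $A$ is a combination without repetition of $m$ primitive terms, i.e. an $m$-element subset of $A$. There are $C^k_m=\binom{k}{m}$ of them; for $m=0$ the only one is the empty combination. The con$(k-2)$nations of $A$ are numbered $S_1,S_2,\dots,S_N$ with $N=\binom{k}{k-2}$, in a fixed order (lexicographic order in the indices). The con$(k-2)$nation $S_j$ is denoted by the fraction $\frac{j}{k-2}$: the denominator is the class number (the number of primitive terms in the combination) and the numerator is the number assigned to the combination in its class. These fractions are formal symbols, not numbers. A semi-fractional term is a formal symbol $\frac{j}{k-2}a_i$, the juxtaposition of the fraction $\frac{j}{k-2}$ and a primitive term $a_i$, where $1\le j\le N$ and $a_i\notin S_j$; it represents the con$(k-1)$nation $S_j\cup\{a_i\}$. Two semi-fractional terms $\frac{j}{k-2}a_i$ and $\frac{j'}{k-2}a_{i'}$ are the same symbol if and only if $j=j'$ and $i=i'$ (even though different ones may represent the same con$(k-1)$nation). The language $L(A)$ is the disjoint union of the set of con$(k-1)$nations of $A$ (each one counted as a symbol, written out by its primitive terms) and the set of all semi-fractional terms. For example,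 for $k=4$, the con3nation $(a_1,a_2,a_3)$ is one symbol, and, with the con2nations numbered $(1)\,a_1a_2$, $(2)\,a_1a_3$, $(3)\,a_1a_4$, $(4)\,a_2a_3$, $(5)\,a_2a_4$, $(6)\,a_3a_4$, the symbols $\frac12 a_3$, $\frac22 a_2$, $\frac42 a_1$ are three further distinct symbols representing it. *)

(* Defs.v *)
From HB Require Import structures.
From mathcomp Require Import all_boot all_order.
From mathcomp Require Import finmap.

Set Implicit Arguments.
Unset Strict Implicit.
Unset Printing Implicit Defensive.

Local Open Scope fset_scope.

(* [Con B] is a combination written out by its primitive terms, whose order is
   irrelevant. [SemiFrac j m x] is the formal juxtaposition (j/m)x: it is
   identified neither with the combination it represents nor with another
   (j'/m)x' representing the same combination. *)
Inductive symbol (T : choiceType) : Type :=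
  | Con of {fset T}
  | SemiFrac of nat & nat & T.

Arguments SemiFrac {T}.

Definition symbol_encode (T : choiceType) (s : symbol T) :
    {fset T} + nat * nat * T :=
  match s with Con B => inl B | SemiFrac j m x => inr (j, m, x) end.

Definition symbol_decode (T : choiceType) (s : {fset T} + nat * nat * T) :
    symbol T :=
  match s with inl B => Con B | inr (j, m, x) => SemiFrac j m x end.

Lemma symbol_encodeK (T : choiceType) :
  cancel (@symbol_encode T) (@symbol_decode T).
Proof. by case. Qed.

HB.instance Definition _ (T : choiceType) :=
  Choice.copy (symbol T) (can_type (@symbol_encodeK T)).

Section Language.

(* [a i] is the primitive term with index i.+1. *)
Variables (T : choiceType) (k : nat) (a : 'I_k -> T).

Definition primitive_terms : {fset T} := [fset a i | i in 'I_k].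

Definition con_nations (m : nat) : {fset {fset T}} :=
  [fset B in fpowerset primitive_terms | #|` B| == m].

Definition indices (B : {fset T}) : seq nat :=
  [seq nat_of_ord i | i <- enum 'I_k & a i \in B].

Definition lex_le (B B' : {fset T}) : bool :=
  (indices B <= indices B' :> seqlexi nat)%O.

(* The combination denoted by j/m for 1 <= j <= 'C(k, m); the value at other j
   is junk. *)
Definition con_nation (j m : nat) : {fset T} :=
  nth fset0 (sort lex_le (con_nations m)) j.-1.

Definition represented (s : symbol T) : {fset T} :=
  match s with
  | Con B => B
  | SemiFrac j m x => x |` con_nation j m
  end.

Definition semi_fractional_terms (m : nat) : {fset symbol T} :=
  [fset SemiFrac j m x | j : nat in iota 1 'C(k, m),
                         x : T in primitive_terms `\` con_nation j m].

Definition language : {fset symbol T} :=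
  [fset Con B | B in con_nations (k - 1)] `|` semi_fractional_terms (k - 2).

Hypothesis a_inj : injective a.

Lemma card_primitive_terms : #|` primitive_terms| = k.
Proof. by rewrite card_imfset //= -cardE card_ord. Qed.

Lemma mem_con_nations m B :
  (B \in con_nations m) = (B `<=` primitive_terms) && (#|` B| == m).
Proof. by rewrite !inE /= fpowersetE. Qed.

Lemma card_con_nations m : #|` con_nations m| = 'C(k, m).
Proof.
pose f (X : {set 'I_k}) := [fset a i | i in X].
have -> : con_nations m = [fset f X | X in [set X : {set 'I_k} | #|X| == m]].
  apply/fsetP => B; rewrite mem_con_nations; apply/idP/imfsetP => /=.
    case/andP=> sB cB; exists [set i | a i \in B].
      rewrite inE -(eqP cB) -[X in _ == X](_ : #|` f [set i | a i \in B]| = _).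
        by rewrite /f card_imfset //= cardE.
      congr (#|` _|); apply/fsetP => x; apply/imfsetP/idP => /= [[i]|xB].
        by rewrite inE => ? ->.
      by have /imfsetP[i _ xi] := fsubsetP sB _ xB; exists i => //;
        rewrite inE -xi.
    apply/fsetP => x; apply/idP/imfsetP => /= [xB|[i]].
      by have /imfsetP[i _ xi] := fsubsetP sB _ xB; exists i => //;
        rewrite inE -xi.
    by rewrite inE => ? ->.
  case=> X; rewrite inE => cX ->; rewrite /f card_imfset //= -cardE cX andbT.
  by apply/fsubsetP => x /imfsetP[i _ ->]; apply/imfsetP; exists i.
rewrite card_imfset /=; first by rewrite -cardE card_draws card_ord.
move=> X Y /fsetP e; apply/setP => i; have := e (a i).
by rewrite !mem_imfset.
Qed.

Lemma con_nation_mem m j : 1 <= j <= 'C(k, m) ->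
  con_nation j m \in con_nations m.
Proof.
move=> /andP[j1 jN]; rewrite /con_nation -(mem_sort lex_le).
by apply: mem_nth; rewrite size_sort card_con_nations prednK.
Qed.

Lemma represented_mem (s : symbol T) :
  1 < k -> s \in language -> represented s \in con_nations (k - 1).
Proof.
move=> k_gt1 /fsetUP[/imfsetP[B ? ->] //|/imfset2P[j + [x + ->]]].
rewrite mem_iota add1n ltnS => /con_nation_mem.
rewrite in_fsetD !mem_con_nations /= => /andP[sB /eqP cB] /andP[xNB xA].
rewrite fsubUset fsub1set xA sB cardfsU1 xNB cB subn1 subn2 add1n /=.
by case: (k) k_gt1 => [|[|n]] //=; rewrite eqxx.
Qed.

End Language.

(* Main.v *)
Require Import Defs.
From mathcomp Require Import all_boot all_order.
From mathcomp Require Import finmap.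

(** Symbols are counted as formal objects, whatever they represent. There are [k] con(k-1)nations.
    Each of the ['C(k, 2)] fractions can be followed by either of the two primitive terms missing
    from its combination, which gives [k * (k - 1)] semi-fractional terms
    ([card_semi_fractional_terms]). The two kinds are disjoint, and [k + k * (k - 1) = k ^ 2]. *)

Lemma card_semi_fractional_terms (T : choiceType) (k : nat) (a : 'I_k -> T)
    (m : nat) :
  injective a -> #|` semi_fractional_terms a m| = 'C(k, m) * (k - m).
Proof.
(* Distinct pairs [(j, x)] give distinct symbols, so the count is a double sum over [j] and [x]. *)
move=> a_inj; rewrite card_fset_sum1 big_imfset2 /=; last first.
  by move=> [j x] [j' x'] _ _ /= [-> ->].
rewrite undup_id ?iota_uniq // big_seq (eq_bigr (fun=> k - m)) => [|j].
  by rewrite -big_seq big_const_seq count_predT size_iota iter_addn_0 mulnC.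
(* The range of [j] excludes the junk values of [con_nation], so exactly [m] of the [k] primitive
   terms are removed. *)
rewrite mem_iota add1n ltnS => /(con_nation_mem a_inj).
rewrite mem_con_nations => /andP[sSA /eqP cS].
by rewrite -card_fset_sum1 cardfsDS // cS card_primitive_terms.
Qed.

Lemma disjoint_con_semi_fractional_terms (T : choiceType) (k : nat)
    (a : 'I_k -> T) (X : {fset {fset T}}) (m : nat) :
  [disjoint [fset Con B | B in X] & semi_fractional_terms a m]%fset.
Proof.
by apply/fdisjointP => t /imfsetP[B _ ->]; apply/imfset2P => -[j _ [x _]].
Qed.

Lemma card_language (T : choiceType) (k : nat) (a : 'I_k -> T) :
  injective a ->
  #|` language a| = 'C(k, k - 1) + 'C(k, k - 2) * (k - (k - 2)).
Proof.
move=> a_inj; rewrite /language.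
have /eqP disj :=
  disjoint_con_semi_fractional_terms T k a (con_nations a (k - 1)) (k - 2).
rewrite cardfsU disj cardfs0 subn0 card_semi_fractional_terms //.
by rewrite card_imfset => [|B C [->] //]; rewrite /= card_con_nations.
Qed.

Theorem mainTheorem1 (T : choiceType) (k : nat) (a : 'I_k -> T)
    (hk : 2 <= k) (ha : injective a) :
  #|` language a| = k ^ 2.
Proof.
rewrite card_language // !bin_sub //; last exact: ltnW.
rewrite subKn // bin1 muln2 bin2 halfK.
(* [halfK] leaves a parity correction, which vanishes because [k * k.-1] is a product of consecutive
   integers. *)
case: k hk {a ha} => // n _ /=.
by rewrite oddM /= andNb subn0 -mulnS.
Qed.
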